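(* Let $d,n\ge1$ and $\alpha\in(0,1)$. Let $\hat C_n$ be any algorithm that only outputs confidence intervals (i.e. $\hat C_n(x)$ is always an interval in $\mathbb{R}$) and satisfies $(1-\alpha/2)$-Predictive. Then $\hat C_n$ satisfies $(1-\alpha)$-Median.
   Context: An algorithm $\hat C_n$ maps training data $\mathcal D=\{(X_1,Y_1),\ldots,(X_n,Y_n)\}\subset\mathbb{R}^d\times\mathbb{R}$ to sets $\hat C_n(x)\subseteq\mathbb{R}$ for each $x\in\mathbb{R}^d$ (measurable so that the events below are well defined). $\mathrm{Median}(Y\mid X=x)$ is a median of the conditional distribution of $Y$ given $X=x$, i.e. a point $m$ with $\mathbb{P}\{Y\le m\mid X=x\}\ge 1/2$ and $\mathbb{P}\{Y\ge m\mid X=x\}\ge 1/2$ (if not unique, a fixed choice, measurable in $x$, is made). For $\beta\in(0,1)$, $\hat C_n$ satisfies $\beta$-Predictive if $\mathbb{P}\{Y_{n+1}\in\hat C_n(X_{n+1})\}\ge \beta$ for every probability distribution $P$ on $\mathbb{R}^d\times\mathbb{R}$, and satisfies $\beta$-Median if $\mathbb{P}\{\mathrm{Median}(Y_{n+1}\mid X_{n+1})\in\hat C_n(X_{n+1})\}\ge \beta$ for every probability distribution $P$ on $\mathbb{R}^d\times\mathbb{R}$; in both cases $(X_1,Y_1),\ldots,(X_{n+1},Y_{n+1})$ are i.i.d. from $P$ and the probability is over the training data and the test point. *)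

(* Defs.v *)
From HB Require Import structures.
From mathcomp Require Import all_boot all_order all_algebra.
From mathcomp Require Import all_classical all_reals all_analysis.

Set Implicit Arguments.
Unset Strict Implicit.
Unset Printing Implicit Defensive.

Import Order.TTheory GRing.Theory Num.Theory.
Import numFieldNormedType.Exports.

Local Open Scope classical_set_scope.
Local Open Scope ring_scope.
Local Open Scope ereal_scope.

(* R^d with the product sigma-algebra of the Borel sigma-algebra of R, which is
   the Borel sigma-algebra of R^d. *)
Notation covariates d R := (d.-tuple (measurableTypeR R)).

Definition mutually_independent (R : realType) (disp : measure_display)
    (Omega : measurableType disp) (Pr : probability Omega R)
    (disp' : measure_display) (T : measurableType disp') (k : nat)
    (Z : 'I_k -> {RV Pr >-> T}) : Prop :=
  forall (J : {set 'I_k}) (A : 'I_k -> set T),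
    (forall i, i \in J -> measurable (A i)) ->
    Pr (\bigcap_(i in [set` J]) (Z i @^-1` A i))
    = \prod_(i in J) Pr (Z i @^-1` A i).

Definition iid_from (R : realType) (disp : measure_display)
    (Omega : measurableType disp) (Pr : probability Omega R)
    (disp' : measure_display) (T : measurableType disp')
    (P : probability T R) (k : nat) (Z : 'I_k -> {RV Pr >-> T}) : Prop :=
  mutually_independent Z /\
  forall i (A : set T), measurable A -> distribution Pr (Z i) A = P A.

(* Regular conditional distribution of the second coordinate given the first;
   it is determined by P only up to a null set of the first marginal. *)
Definition is_conditional_distribution (R : realType)
    (dx dy : measure_display) (X : measurableType dx) (Y : measurableType dy)
    (P : probability (X * Y)%type R) (kappa : R.-pker X ~> Y) : Prop :=
  forall (A : set X) (B : set Y), measurable A -> measurable B ->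
    P (A `*` B) = \int[pushforward P fst]_(x in A) kappa x B.

Definition is_median (R : realType) (Q : {measure set (measurableTypeR R) -> \bar R})
    (m : R) : Prop :=
  (2^-1)%:E <= Q [set y | (y <= m)%R] /\ (2^-1)%:E <= Q [set y | (m <= y)%R].

(* A measurable choice med x of Median(Y | X = x) for (X, Y) ~ P. *)
Definition is_conditional_median (R : realType) (dx : measure_display)
    (X : measurableType dx) (P : probability (X * measurableTypeR R)%type R)
    (med : X -> measurableTypeR R) : Prop :=
  measurable_fun [set: X] med /\
  exists2 kappa : R.-pker X ~> measurableTypeR R,
    is_conditional_distribution P kappa & forall x, is_median (kappa x) (med x).

(* An algorithm maps n labelled points and a test covariate to a set of
   responses. *)
Definition algorithm (R : realType) (d n : nat) : Type :=
  n.-tuple (covariates d R * measurableTypeR R) -> covariates d R -> set R.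

(* Joint measurability in (training data, x, y) of the relation y \in C(x): the
   events in [predictive] and [median_covering] are then measurable. *)
Definition measurable_algorithm (R : realType) (d n : nat)
    (C : algorithm R d n) : Prop :=
  measurable [set z : n.-tuple (covariates d R * measurableTypeR R)
                      * (covariates d R * measurableTypeR R)
             | C z.1 z.2.1 z.2.2].

(* The first n points are the training data, the one of index ord_max = n is
   the test point. *)
Definition training (R : realType) (d n : nat) (disp : measure_display)
    (Omega : measurableType disp) (Pr : probability Omega R)
    (Z : 'I_n.+1 -> {RV Pr >-> (covariates d R * measurableTypeR R)%type})
    (w : Omega) : n.-tuple (covariates d R * measurableTypeR R) :=
  [tuple Z (widen_ord (leqnSn n) i) w | i < n].

Definition predictive (R : realType) (d n : nat) (beta : R)
    (C : algorithm R d n) : Prop :=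
  forall (P : probability (covariates d R * measurableTypeR R)%type R)
    (disp : measure_display) (Omega : measurableType disp)
    (Pr : probability Omega R)
    (Z : 'I_n.+1 -> {RV Pr >-> (covariates d R * measurableTypeR R)%type}),
  iid_from P Z ->
  beta%:E <= Pr [set w | C (training Z w) (Z ord_max w).1 (Z ord_max w).2].

Definition median_covering (R : realType) (d n : nat) (beta : R)
    (C : algorithm R d n) : Prop :=
  forall (P : probability (covariates d R * measurableTypeR R)%type R)
    (med : covariates d R -> measurableTypeR R),
  is_conditional_median P med ->
  forall (disp : measure_display) (Omega : measurableType disp)
    (Pr : probability Omega R)
    (Z : 'I_n.+1 -> {RV Pr >-> (covariates d R * measurableTypeR R)%type}),
  iid_from P Z ->
  beta%:E <=
    Pr [set w | C (training Z w) (Z ord_max w).1 (med (Z ord_max w).1)].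

(* Main.v *)
Require Import Defs.
From HB Require Import structures.
From mathcomp Require Import all_boot all_order all_algebra.
From mathcomp Require Import all_classical all_reals all_analysis.
From mathcomp Require Import measurable_realfun lra.
Import Order.TTheory GRing.Theory Num.Theory.
Import numFieldNormedType.Exports.
Local Open Scope ring_scope.

(** An interval that misses a point m lies strictly on one side of m (or is
    empty).  If m is a median of the law of Y, the opposite closed half-line
    carries mass at least 1/2, so the interval misses Y with probability at
    least 1/2.  Applied to the conditional law of the test response given the
    training data and the test covariate, this says that missing the
    conditional median costs at least half as much in missed responses:
    Pr(median missed) <= 2 Pr(response missed) <= 2 (alpha / 2) = alpha.

    Two facts turn the conditional argument into an integrated one.  First,
    the training data and the test point are jointly distributed as the product
    of their laws ([initial_segment_last_law]), so the training data can be
    fixed: mutual independence only gives the product rule for one event per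
    point, and it is extended from boxes to all events on the training tuple by
    uniqueness of measures on a pi-system.  Second, the defining identity of a
    conditional distribution on rectangles determines P on every measurable set
    ([disintegration]); this is needed because the event that the response is
    missed is not a rectangle.  With the training data fixed,
    [miss_median_le_miss] integrates the pointwise bound of
    [interval_misses_median] over the covariate. *)

(** * Disintegration on arbitrary measurable sets *)

Section Disintegration.
Local Open Scope classical_set_scope.
Local Open Scope ereal_scope.
Context {dx dy : measure_display} {X : measurableType dx}
  {Y : measurableType dy} {R : realType}.

Definition semidirect_product (m : {measure set X -> \bar R})
    (k : R.-pker X ~> Y) (S : set (X * Y)) : \bar R :=
  \int[m]_x k x (xsection S x).

Lemma measurable_kernel_xsection (k : R.-pker X ~> Y) (S : set (X * Y)) :
  measurable S ->
  measurable_fun [set: X] (fun x => k x (xsection S x)).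
Proof.
by move=> mS; apply: measurable_fun_xsection_finite_kernel; rewrite inE.
Qed.

Section SemidirectMeasure.
Context (m : {measure set X -> \bar R}) (k : R.-pker X ~> Y).

Let sd0 : semidirect_product m k set0 = 0.
Proof. by rewrite [LHS]integral0_eq// => x/= _; rewrite xsection0. Qed.

Let sd_ge0 S : 0 <= semidirect_product m k S.
Proof. exact: integral_ge0. Qed.

Let sd_sigma_additive : semi_sigma_additive (semidirect_product m k).
Proof.
move=> F mF tF mUF.
rewrite [X in _ --> X](_ : _ = \sum_(i <oo) semidirect_product m k (F i)).
  apply/cvg_closeP; split; last by rewrite closeE.
  by apply: is_cvg_nneseries => *; exact: sd_ge0.
rewrite -integral_nneseries//; last first.
  by move=> i; exact: measurable_kernel_xsection.
apply: eq_integral => x _; apply/esym/cvg_lim => //=; rewrite xsection_bigcup.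
apply: (measure_sigma_additive _ (trivIset_xsection tF)) => i.
exact: measurable_xsection.
Qed.

HB.instance Definition _ := isMeasure.Build _ _ _ (semidirect_product m k)
  sd0 sd_ge0 sd_sigma_additive.

End SemidirectMeasure.

(** Both sides are measures in S that agree on the pi-system of rectangles:
    there the section of A `*` B at x is B or empty according to x \in A. *)
Lemma disintegration (P : probability (X * Y)%type R) (k : R.-pker X ~> Y)
    (S : set (X * Y)) :
  is_conditional_distribution P k -> measurable S ->
  P S = \int[pushforward P fst]_x k x (xsection S x).
Proof.
move=> Pk mS.
pose m : {measure set X -> \bar R} :=
  distribution P (mfun_Sub (mem_set (@measurable_fst _ _ X Y))).
rewrite -[RHS]/(semidirect_product m k S).
apply: (measure_unique [set A `*` B | A in measurable & B in measurable]
  (fun=> setT)) => //.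
- by rewrite measurable_prod_measurableType.
- move=> _ _ [A mA [B mB <-]] [A' mA' [B' mB' <-]].
  exists (A `&` A'); first exact: measurableI.
  by exists (B `&` B'); [exact: measurableI|rewrite setXI].
- by move=> _; exists setT => //; exists setT => //; rewrite setXTT.
- by rewrite bigcup_const.
- move=> _ [A mA [B mB <-]].
  rewrite [LHS]Pk// integral_mkcond; apply: eq_integral => x _.
  rewrite patchE; have [xA|xA] := boolP (x \in A).
    by rewrite in_xsectionX.
  by rewrite notin_xsectionX// measure0.
- by move=> _; rewrite (le_lt_trans (probability_le1 P measurableT)) ?ltry.
Qed.

End Disintegration.

(** * Intervals that miss the conditional median *)

Section Miss.
Local Open Scope classical_set_scope.
Local Open Scope ereal_scope.
Context {R : realType}.

(** The side of m on which I lies is not decided measurably; only the measure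
    of the complement of I enters the bound, so a classical case split is
    enough. *)
Lemma interval_misses_median
    (Q : {measure set (measurableTypeR R) -> \bar R}) (m : R)
    (I : set (measurableTypeR R)) :
  is_median Q m -> is_interval (I : set R) -> measurable I -> ~ I m ->
  (2^-1)%:E <= Q (~` I).
Proof.
move=> [Qle Qge] itvI mI Im.
have mle : measurable ([set y | (y <= m)%R] : set (measurableTypeR R)).
  by rewrite -set_itvNyc; exact: measurable_itv.
have mge : measurable ([set y | (m <= y)%R] : set (measurableTypeR R)).
  by rewrite -set_itvcy; exact: measurable_itv.
have mIC : measurable (~` I) by exact: measurableC.
have [[a Ia am]|nlow] := pselect (exists2 a, I a & (a <= m)%R).
  (* A point of I on each side of m would put m in I by convexity. *)
  apply: (le_trans Qge); apply: le_measure; rewrite ?inE// => y /= my Iy.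
  by apply: Im; apply: (itvI a y) => //; rewrite am.
apply: (le_trans Qle); apply: le_measure; rewrite ?inE// => y /= ym Iy.
by apply: nlow; exists y.
Qed.

(** For one fixed set-valued map I, as obtained by fixing the training data.
    Whether the median is missed depends on the covariate x alone, so the left
    side is the integral of an indicator against the marginal law of x, to be
    compared pointwise with the conditional probability of missing the
    response. *)
Lemma miss_median_le_miss {dx : measure_display} {X : measurableType dx}
    (P : probability (X * measurableTypeR R)%type R)
    (med : X -> measurableTypeR R) (I : X -> set R) :
  is_conditional_median P med -> (forall x, is_interval (I x)) ->
  measurable [set z : X * measurableTypeR R | I z.1 z.2] ->
  (2^-1)%:E * P [set z | ~ I z.1 (med z.1)] <= P [set z | ~ I z.1 z.2].
Proof.
move=> [mmed [k Pk kmed]] itvI mI.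
have mbad : measurable [set z : X * measurableTypeR R | ~ I z.1 z.2].
  exact: measurableC.
pose G := [set x | ~ I x (med x)].
have mG : measurable G.
  have mf : measurable_fun [set: X] (fun x => (x, med x)).
    by apply: measurable_fun_pair.
  rewrite [G](_ : _ = [set: X] `&` (fun x => (x, med x)) @^-1`
    [set z : X * measurableTypeR R | ~ I z.1 z.2]); last by rewrite setTI.
  exact: mf.
rewrite (disintegration _ _ _ Pk mbad).
rewrite -[P [set z | ~ I z.1 (med z.1)]]/(pushforward P fst G).
rewrite -[G]setIT -integral_indic// -ge0_integralZl//; last first.
  exact/measurable_EFinP.
apply: ge0_le_integral => //.
- exact/measurable_funeM/measurable_EFinP.
- exact: measurable_kernel_xsection.
move=> x _; rewrite indicE; have [/set_mem Gx|_] := boolP (x \in G).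
  rewrite mule1.
  have -> : xsection [set z : X * measurableTypeR R | ~ I z.1 z.2] x
      = ~` (I x : set (measurableTypeR R)).
    by rewrite xsectionE.
  apply: (interval_misses_median _ (med x)) => //.
  have := measurable_xsection x mI.
  by rewrite xsectionE.
by rewrite mule0.
Qed.

End Miss.

(** * Independence of the training data and the test point *)

Section Independence.
Local Open Scope classical_set_scope.
Local Open Scope ereal_scope.

(** The pi-system that generates the sigma-algebra of n.-tuple T and on which
    mutual independence is directly usable. *)
Definition boxes {disp : measure_display} (T : measurableType disp) (n : nat) :
    set (set (n.-tuple T)) :=
  [set [set t | forall i, A i (tnth t i)] |
    A in [set A : 'I_n -> set T | forall i, measurable (A i)]].

Lemma boxes_setI_closed {disp : measure_display} (T : measurableType disp)
  (n : nat) : setI_closed (boxes T n).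
Proof.
move=> _ _ [A mA <-] [B mB <-].
exists (fun i => A i `&` B i); first by move=> i; exact: measurableI.
by apply/seteqP; split=> [t tAB|t [tA tB] i]; [split=> i; case: (tAB i)|split].
Qed.

Lemma boxes_setT {disp : measure_display} (T : measurableType disp) (n : nat) :
  boxes T n setT.
Proof. by exists (fun=> setT) => //; apply/seteqP; split. Qed.

Lemma measurable_tuple_boxes {disp : measure_display} (T : measurableType disp)
    (n : nat) :
  @measurable _ (n.-tuple T) = <<s boxes T n >>.
Proof.
apply/seteqP; split; last first.
  apply: smallest_sub; first exact: sigma_algebra_measurable.
  move=> _ [A mA <-].
  rewrite (_ : [set t | _] = \bigcap_(i in [set: 'I_n])
      ((fun t : n.-tuple T => tnth t i) @^-1` A i)); last first.
    by apply/seteqP; split=> [t tA i _|t tA i]; [exact: tA|exact: (tA i)].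
  apply: fin_bigcap_measurable => // i _.
  by rewrite -[X in measurable X]setTI; exact: measurable_tnth.
apply: smallest_sub; first exact: smallest_sigma_algebra.
rewrite -bigcup_seq => _ [i _ [A mA <-]]; rewrite setTI.
apply: sub_sigma_algebra.
exists (fun j => if j == i then A else setT); first by move=> j; case: ifP.
apply/seteqP; split=> [t /(_ i)|t tA j] /=; first by rewrite eqxx.
by case: eqP => [->|].
Qed.

Context {R : realType} {dO disp : measure_display} {Omega : measurableType dO}
  {T : measurableType disp} {Pr : probability Omega R} {n : nat}
  (Z : 'I_n.+1 -> {RV Pr >-> T}).

(** The training data of the learning problem, for observations in any
    measurable type. *)
Definition initial_segment (w : Omega) : n.-tuple T :=
  [tuple Z (widen_ord (leqnSn n) i) w | i < n].

Lemma measurable_initial_segment : measurable_fun setT initial_segment.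
Proof.
apply/measurable_fun_tnthP => i.
rewrite (_ : _ \o _ = Z (widen_ord (leqnSn n) i)).
  exact: measurable_funPT.
by apply/funext => w /=; rewrite tnth_mktuple.
Qed.

HB.instance Definition _ := isMeasurableFun.Build _ _ _ _ initial_segment
  measurable_initial_segment.

Lemma box_product_rule (A : 'I_n -> set T) (E : set T) :
  mutually_independent Z -> (forall i, measurable (A i)) -> measurable E ->
  Pr (initial_segment @^-1` [set t | forall i, A i (tnth t i)]
      `&` Z ord_max @^-1` E)
  = \prod_(i < n) Pr (Z (widen_ord (leqnSn n) i) @^-1` A i)
    * Pr (Z ord_max @^-1` E).
Proof.
move=> indZ mA mE.
pose B (i : 'I_n.+1) := if unlift ord_max i is Some j then A j else E.
have widenE (i : 'I_n) : widen_ord (leqnSn n) i = lift ord_max i.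
  by apply: val_inj; rewrite /= /bump leqNgt ltn_ord.
have BA (i : 'I_n) : B (widen_ord (leqnSn n) i) = A i.
  by rewrite /B widenE liftK.
have BE : B ord_max = E by rewrite /B unlift_none.
have mB i : i \in finset.setTfor 'I_n.+1 -> measurable (B i).
  by move=> _; rewrite /B; case: unlift.
have := indZ (finset.setTfor 'I_n.+1) B mB.
under [in X in _ = X -> _]eq_bigl do rewrite finset.in_setT.
rewrite big_ord_recr/= BE.
under [in X in _ = X -> _]eq_bigr do rewrite BA.
move=> <-; congr (Pr _); apply/seteqP; split=> w /=.
- move=> [wA wE] i _; case: (unliftP ord_max i) => [j ->|->] /=.
    by have := wA j; rewrite tnth_mktuple -widenE BA.
  by rewrite BE.
- move=> wB; split=> [i|].
    rewrite tnth_mktuple -BA; apply: wB.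
    by rewrite /= finset.in_setT.
  by rewrite -BE; apply: wB; rewrite /= finset.in_setT.
Qed.

(** For fixed E both sides are finite measures in B, so it suffices to compare
    them on boxes. *)
Lemma initial_segment_independent (B : set (n.-tuple T)) (E : set T) :
  mutually_independent Z -> measurable B -> measurable E ->
  Pr (initial_segment @^-1` B `&` Z ord_max @^-1` E)
  = Pr (initial_segment @^-1` B) * Pr (Z ord_max @^-1` E).
Proof.
move=> indZ mB mE.
have mZE : measurable (Z ord_max @^-1` E).
  by rewrite -[X in measurable X]setTI; exact: measurable_funPT.
have PrE : Pr (Z ord_max @^-1` E) \is a fin_num by exact: fin_num_measure.
pose c : {nonneg R} := NngNum (fine_ge0 (measure_ge0 Pr (Z ord_max @^-1` E))).
pose PrZE : {measure set Omega -> \bar R} := mrestr Pr mZE.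
pose law : {measure set (n.-tuple T) -> \bar R} :=
  pushforward PrZE initial_segment.
pose m1 := law measurable_initial_segment.
pose m2 : {measure set (n.-tuple T) -> \bar R} :=
  mscale c (distribution Pr initial_segment).
rewrite muleC -[X in X * _](fineK PrE).
rewrite -[RHS]/(m2 B) -[LHS]/(m1 B).
apply: (measure_unique (boxes T n) (fun=> setT)) => //.
- exact: measurable_tuple_boxes.
- exact: boxes_setI_closed.
- by move=> _; exact: boxes_setT.
- by rewrite bigcup_const.
- (* The choice E = setT identifies the product over the first n points with
     the probability of the box. *)
  move=> _ [A mA <-]; rewrite /m1 /m2 /= /mscale /= fineK//.
  rewrite [LHS]box_product_rule// muleC; congr (_ * _).
  have := box_product_rule A setT indZ mA measurableT.
  by rewrite preimage_setT setIT probability_setT mule1.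
- move=> _; rewrite (le_lt_trans _ (ltry 1))//.
  by rewrite /m1 /= /pushforward /mrestr preimage_setT setTI probability_le1.
Qed.

Lemma initial_segment_last_law (P : probability T R)
    (S : set (n.-tuple T * T)) :
  iid_from P Z -> measurable S ->
  Pr [set w | S (initial_segment w, Z ord_max w)]
  = \int[pushforward Pr initial_segment]_t P (xsection S t).
Proof.
move=> [indZ lawZ] mS.
have mf : measurable_fun setT (fun w => (initial_segment w, Z ord_max w)).
  by apply: measurable_fun_pair; exact: measurable_funPT.
pose f : {mfun Omega >-> (n.-tuple T * T)%type} := mfun_Sub (mem_set mf).
rewrite -[LHS]/(distribution Pr f S).
rewrite -[RHS]/((distribution Pr initial_segment \x P) S).
apply/esym/product_measure_unique => // A B mA mB.
rewrite [LHS]initial_segment_independent//; congr (_ * _).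
exact: lawZ.
Qed.

End Independence.

(** * Coverage of the conditional median *)

Theorem theorem6 (R : realType) (d n : nat) (alpha : R) (C : algorithm R d n)
    (d_ge1 : (1 <= d)%N) (n_ge1 : (1 <= n)%N)
    (alpha_gt0 : 0 < alpha) (alpha_lt1 : alpha < 1)
    (C_measurable : measurable_algorithm C)
    (C_interval : forall data x, is_interval (C data x)) :
  predictive (1 - alpha / 2) C -> median_covering (1 - alpha) C.
Proof.
move=> Cpred P med Pmed disp Omega Pr Z iidZ.
have [mmed _] := Pmed.
pose Miss := [set z : n.-tuple (covariates d R * measurableTypeR R)
    * (covariates d R * measurableTypeR R) | ~ C z.1 z.2.1 z.2.2]%classic.
pose MissMed := [set z : n.-tuple (covariates d R * measurableTypeR R)
    * (covariates d R * measurableTypeR R) | ~ C z.1 z.2.1 (med z.2.1)]%classic.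
have mMiss : measurable Miss by exact: measurableC.
have mMissMed : measurable MissMed.
  pose f (z : n.-tuple (covariates d R * measurableTypeR R)
    * (covariates d R * measurableTypeR R)) := (z.1, (z.2.1, med z.2.1)).
  have mf : measurable_fun setT f.
    apply: measurable_fun_pair => //; apply: measurable_fun_pair.
      exact: measurableT_comp.
    by apply: measurableT_comp => //; exact: measurableT_comp.
  by rewrite -[MissMed]setTI; exact: (mf measurableT Miss).
pose f (w : Omega) := (initial_segment Z w, Z ord_max w).
have mf : measurable_fun setT f.
  by apply: measurable_fun_pair; exact: measurable_funPT.
have mMissf : measurable (f @^-1` Miss)%classic.
  by rewrite -[X in measurable X]setTI; exact: mf.
have mMissMedf : measurable (f @^-1` MissMed)%classic.
  by rewrite -[X in measurable X]setTI; exact: mf.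
(* By independence the training data t can be fixed, which leaves the bound
   for the single map C t. *)
have half : ((2^-1)%:E * Pr (f @^-1` MissMed)%classic
    <= Pr (f @^-1` Miss)%classic)%E.
  rewrite (initial_segment_last_law Z P MissMed iidZ mMissMed).
  rewrite (initial_segment_last_law Z P Miss iidZ mMiss).
  rewrite -ge0_integralZl//; last first.
    exact: measurable_fun_xsection.
  apply: ge0_le_integral => //.
  - by move=> t _; rewrite mule_ge0// lee_fin invr_ge0.
  - exact/measurable_funeM/measurable_fun_xsection.
  - exact: measurable_fun_xsection.
  move=> t _.
  have -> : xsection MissMed t = [set z | ~ C t z.1 (med z.1)]%classic.
    by rewrite xsectionE.
  have -> : xsection Miss t = [set z | ~ C t z.1 z.2]%classic.
    by rewrite xsectionE.
  apply: (miss_median_le_miss P med (C t)) => //.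
  have := measurable_xsection t C_measurable.
  by rewrite xsectionE.
have := Cpred P disp Omega Pr Z iidZ.
rewrite -[X in Pr X](setCK _) [X in (_ <= X)%E -> _]probability_setC//.
rewrite -[X in _ -> (_ <= Pr X)%E](setCK _).
rewrite [X in _ -> (_ <= X)%E]probability_setC//.
move: half; rewrite -[(f @^-1` Miss)%classic]/(~` _)%classic.
rewrite -(fineK (fin_num_measure Pr _ mMissf)).
rewrite -(fineK (fin_num_measure Pr _ mMissMedf)).
rewrite -!EFinM -!EFinB !lee_fin.
lra.
Qed.
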